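(* Let $R,R_1\ge0$ be compact self-adjoint operators on a separable Hilbert space $\mathcal H$ with $\operatorname{Ker}R=\{0\}$, and let $p\in\mathcal H$ satisfy $R^2-R_1^2=pp^*$. With the notation $\mathcal H_0,\lambda_k,\mu_k,\mathcal K,\mathcal K_1,p_k,p_k^1$ of the context, assume that $\mathcal H=\mathcal H_0\oplus\mathcal K\oplus\mathcal K_1$. Let $\boldsymbol\varphi$ be a unitary operator commuting with $R$ and let $\boldsymbol\varphi_1$ be a partial isometry commuting with $R_1$, with initial and final space both equal to $(\operatorname{Ker}R_1)^\perp$, such that $\boldsymbol\varphi|_{\mathcal K_1}=I_{\mathcal K_1}$, $\boldsymbol\varphi_1|_{\mathcal K}=I_{\mathcal K}$, and such that for every $k$ the vector $p_k$ is $*$-cyclic for $\boldsymbol\varphi|_{\operatorname{Ker}(R-\lambda_kI)}$ and the vector $p_k^1$ is $*$-cyclic for $\boldsymbol\varphi_1|_{\operatorname{Ker}(R_1-\mu_kI)}$. Then the contraction $\Sigma^*=\boldsymbol\varphi_1R_1R^{-1}\boldsymbol\varphi^*$ is asymptotically stable, i.e. $\|(\Sigma^* )^nx\|\to0$ as $n\to\infty$ for every $x\in\mathcal H$.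
   Context: $pp^*$ denotes $x\mapsto\langle x,p\rangle p$. $R^{-1}$ is the densely defined inverse with domain $\operatorname{Ran}R$; since $R_1^2\le R^2$, $R_1R^{-1}$ extends from $\operatorname{Ran}R$ to a contraction on $\mathcal H$, and $\Sigma^*$ is understood with this extension. $\mathcal H_0:=\overline{\operatorname{span}}\{R^np:n\ge0\}$, which is a reducing subspace for $R$ and $R_1$, and $R$ and $R_1$ coincide on $\mathcal H_0^\perp$. $\lambda_1>\lambda_2>\dots>0$ are the eigenvalues of $R|_{\mathcal H_0}$ and $\mu_1>\mu_2>\dots>0$ are the non-zero eigenvalues of $R_1|_{\mathcal H_0}$ (all are simple, and $\lambda_1>\mu_1>\lambda_2>\mu_2>\cdots$). Further, $$\mathcal K:=\overline{\operatorname{span}}\{\operatorname{Ker}(R-\lambda_kI):k\ge1\}\cap\mathcal H_0^\perp,\qquad \mathcal K_1:=\overline{\operatorname{span}}\{\operatorname{Ker}(R_1-\mu_kI):k\ge1\}\cap\mathcal H_0^\perp,$$ and $p_k$, $p_k^1$ are the orthogonal projections of $p$ onto $\operatorname{Ker}(R-\lambda_kI)$ and $\operatorname{Ker}(R_1-\mu_kI)$ respectively. A vector $v$ is $*$-cyclic for a unitary operator $U$ if the closed span of $\{U^nv:n\in\mathbb Z\}$ is the whole space. *)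

(* Defs.v *)
From HB Require Import structures.
#[export] Set Warnings "-notation-overridden,-notation-incompatible-prefix".
From mathcomp Require Export all_boot all_order all_algebra.
From mathcomp Require Export complex.
From mathcomp Require Export all_classical all_reals all_analysis.

Set Implicit Arguments.
Unset Strict Implicit.
Unset Printing Implicit Defensive.

Export Order.TTheory GRing.Theory Num.Theory Num.Def.
Export numFieldNormedType.Exports.

Local Open Scope classical_set_scope.
Local Open Scope ring_scope.
Local Open Scope complex_scope.

(* A Hilbert space is a complete normed module H over F[i] together with a
   positive definite Hermitian form (linear in its first argument) inducing
   the norm of H. *)
Definition induces_norm (F : realType) (H : normedModType F[i])
    (dot : {dot H for conjC}) : Prop :=
  forall x : H, dot x x = `|x| ^+ 2.

Definition separable_space (X : topologicalType) : Prop :=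
  exists D : set X, countable D /\ dense D.

Definition lin_span (F : realType) (H : normedModType F[i]) (A : set H) :
    set H :=
  [set x | exists (n : nat) (c : 'I_n -> F[i]) (v : 'I_n -> H),
     (forall i, A (v i)) /\ x = \sum_(i < n) c i *: v i].

Definition closed_span (F : realType) (H : normedModType F[i]) (A : set H) :
    set H :=
  closure (lin_span A).

Definition orthc (F : realType) (H : normedModType F[i])
    (dot : {dot H for conjC}) (A : set H) : set H :=
  [set x | forall y, A y -> dot x y = 0].

Definition orth_proj (F : realType) (H : normedModType F[i])
    (dot : {dot H for conjC}) (E : set H) (x : H) : H :=
  get [set q | E q /\ orthc dot E (x - q)].

Definition orth_sum3 (F : realType) (H : normedModType F[i])
    (dot : {dot H for conjC}) (A B C : set H) : Prop :=
  [/\ A `<=` orthc dot B, A `<=` orthc dot C, B `<=` orthc dot C &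
      forall x : H, exists a b c, [/\ A a, B b, C c & x = a + b + c]].

Definition ker_op (F : realType) (H : normedModType F[i]) (T : H -> H) :
    set H :=
  [set x | T x = 0].

(* Ker (T - l I) *)
Definition eigspace (F : realType) (H : normedModType F[i]) (T : H -> H)
    (l : F[i]) : set H :=
  ker_op (fun x => T x - l *: x).

(* The eigenvalues of the restriction of T to M. *)
Definition eigvals_on (F : realType) (H : normedModType F[i]) (T : H -> H)
    (M : set H) : set F[i] :=
  [set l | exists x, [/\ M x, x != 0 & T x = l *: x]].

Definition adjoint (F : realType) (H : normedModType F[i])
    (dot : {dot H for conjC}) (T : H -> H) (y : H) : H :=
  get [set z | forall x, dot (T x) y = dot x z].

Definition selfadjoint (F : realType) (H : normedModType F[i])
    (dot : {dot H for conjC}) (T : H -> H) : Prop :=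
  forall x y, dot (T x) y = dot x (T y).

(* In the order of F[i], 0 <= z entails that z is real. *)
Definition nonneg_op (F : realType) (H : normedModType F[i])
    (dot : {dot H for conjC}) (T : H -> H) : Prop :=
  forall x, 0 <= dot (T x) x.

Definition compact_op (F : realType) (H : normedModType F[i]) (T : H -> H) :
    Prop :=
  precompact (T @` [set x | `|x| <= 1]).

Definition unitary_op (F : realType) (H : normedModType F[i])
    (dot : {dot H for conjC}) (U : H -> H) : Prop :=
  (forall x y, dot (U x) (U y) = dot x y) /\ range U = setT.

Definition initial_space (F : realType) (H : normedModType F[i])
    (dot : {dot H for conjC}) (V : H -> H) : set H :=
  orthc dot (ker_op V).

Definition final_space (F : realType) (H : normedModType F[i]) (V : H -> H) :
    set H :=
  range V.

Definition partial_isometry (F : realType) (H : normedModType F[i])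
    (dot : {dot H for conjC}) (V : H -> H) : Prop :=
  continuous V /\ forall x, initial_space dot V x -> `|V x| = `|x|.

Definition commutes (T : Type) (f g : T -> T) : Prop :=
  forall x, f (g x) = g (f x).

(* The vectors (U|E)^n v, n in Z, when U restricts to a bijection of E and v
   lies in E: (U|E)^(-n) v is the w in E such that U^n w = v. *)
Definition orbit_on (T : Type) (U : T -> T) (E : set T) (v : T) : set T :=
  [set w | E w /\ exists n : nat, w = iter n U v \/ iter n U w = v].

Definition star_cyclic_on (F : realType) (H : normedModType F[i])
    (U : H -> H) (E : set H) (v : H) : Prop :=
  closed_span (orbit_on U E v) = E.

(* The inverse of T, meaningful on Ran T when T is injective. *)
Definition op_inv (F : realType) (H : normedModType F[i]) (T : H -> H)
    (y : H) : H :=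
  get [set x | T x = y].

(* The extension of T1 T^-1 from Ran T to a linear contraction on H. The
   identity is only a default value, taken when no such extension exists. *)
Definition contr_ext (F : realType) (H : normedModType F[i])
    (T1 T : H -> H) : H -> H :=
  xget (idfun : H -> H) [set A : H -> H |
    [/\ linear A, forall x, `|A x| <= `|x| &
        forall y, range T y -> A y = T1 (op_inv T y)]].

(* phi1 R1 R^-1 phi^* *)
Definition Sigma_star (F : realType) (H : normedModType F[i])
    (dot : {dot H for conjC}) (R R1 phi phi1 : H -> H) : H -> H :=
  fun x => phi1 (contr_ext R1 R (adjoint dot phi x)).

Definition asymptotically_stable (F : realType) (H : normedModType F[i])
    (T : H -> H) : Prop :=
  forall x, (fun n => `|iter n T x|) @ \oo --> (0 : F[i]^o).

(* Main.v *)
From HB Require Import structures.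
Require Import Defs.
From mathcomp Require Import ring lra.

Set Implicit Arguments.
Unset Strict Implicit.
Unset Printing Implicit Defensive.

Local Open Scope classical_set_scope.
Local Open Scope ring_scope.
Local Open Scope complex_scope.

(** Write T for Sigma^*, psi for phi^* = phi^-1 and W = phi1 psi. Then
    T R = R1 W, and R1 = R B for a contraction B (Douglas), so T R = R (B W) and
    the T-orbit of a vector of Ran R stays in the image under R of a ball: it is
    precompact. A cluster point w of such an orbit is recurrent, i.e.
    T^(n_j) w -> w for some n_j >= 1, and the recurrent vectors for a given
    sequence n_j form a closed subspace M on which T is unitary. For z in M,
      |Rz|^2 = <T R^2 z, T z> = <W R z, R1 T z> <= |Rz| |R1 T z|
             <= |Rz| |R T z|,
    and recurrence forces equality throughout; hence M is orthogonal to p and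
    invariant under R^2, which commutes with T on M. If M <> 0, compactness
    gives a nonzero E = M `&` Ker (R - l I), and T E = E. For x in E,
    u = psi x is an eigenvector of both R and R1 for l, orthogonal to H0, and
    T x = phi1 u. If l is one of the lambda_k then u lies in K and T = phi^-1 on
    E; if l is one of the mu_k then u lies in K1 and T = phi1 on E; otherwise
    u is orthogonal to H0, K and K1. In the first two cases E is orthogonal to
    the orbit of a *-cyclic vector. So E = 0 in all cases, every cluster point
    is 0, T^n -> 0 on Ran R, and Ran R is dense. *)

(** * The underlying real inner product *)

Section RealHilbert.
Context (F : realType) (H : completeNormedModType F[i]).
Context (dot : {dot H for conjC}) (hdot : induces_norm dot).
Implicit Types (x y z v w : H) (a : F[i]) (r : F).

(** The norm of [H] takes values in [F[i]], whose order is only partial. Its real part carries all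
    of it and lies in [F], where [lra] and [nra] apply. *)
Definition nrm x : F := complex.Re `|x|.
Definition re_dot x y : F := complex.Re (dot x y).
Local Notation rdot := re_dot.

Lemma nrmE x : `|x| = (nrm x)%:C.
Proof. by rewrite /nrm RRe_real // ger0_real. Qed.

Lemma nrm_ge0 x : 0 <= nrm x.
Proof. by rewrite -ler0c -nrmE. Qed.

Lemma le_nrm x y : (`|x| <= `|y|) = (nrm x <= nrm y).
Proof. by rewrite !nrmE lecR. Qed.

Lemma nrm0 : nrm 0 = 0.
Proof. by rewrite /nrm normr0. Qed.

Lemma nrm_eq0 x : nrm x = 0 -> x = 0.
Proof. by move=> h; apply/eqP; rewrite -normr_eq0 nrmE h. Qed.

Lemma nrm_gt0 x : x != 0 -> 0 < nrm x.
Proof. by rewrite -normr_gt0 nrmE ltcR. Qed.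

Lemma nrmD x y : nrm (x + y) <= nrm x + nrm y.
Proof. by have := ler_normD x y; rewrite !nrmE -rmorphD /= lecR. Qed.

Lemma nrmN x : nrm (- x) = nrm x.
Proof. by rewrite /nrm normrN. Qed.

Lemma nrmBC x y : nrm (x - y) = nrm (y - x).
Proof. by rewrite -opprB nrmN. Qed.

Lemma nrm_dist x y z : nrm (x - z) <= nrm (x - y) + nrm (y - z).
Proof. by apply: le_trans (nrmD _ _); rewrite addrA subrK. Qed.

Lemma Re_norm_ge0 a : 0 <= complex.Re `|a|.
Proof. by rewrite -ler0c RRe_real // ger0_real. Qed.

Lemma nrmZc a x : nrm (a *: x) = complex.Re `|a| * nrm x.
Proof.
have aE : `|a| = (complex.Re `|a|)%:C by rewrite RRe_real // ger0_real.
by rewrite {1}/nrm normrZ nrmE aE -rmorphM.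
Qed.

Lemma nrmZ r x : 0 <= r -> nrm (r%:C *: x) = r * nrm x.
Proof.
by move=> r0; rewrite nrmZc ger0_norm // ler0c.
Qed.

Lemma rdotxx x : rdot x x = nrm x ^+ 2.
Proof. by rewrite /re_dot hdot nrmE -rmorphXn. Qed.

Lemma rdotC x y : rdot x y = rdot y x.
Proof. by rewrite /re_dot hermC /= expr0 mul1r; case: (dot y x). Qed.

Lemma rdotDl x y z : rdot (x + y) z = rdot x z + rdot y z.
Proof. by rewrite /re_dot linearDl /=; case: (dot x z) (dot y z) => ? ? []. Qed.

Lemma rdotZl r x z : rdot (r%:C *: x) z = r * rdot x z.
Proof. by rewrite /re_dot linearZl_LR /=; case: (dot x z) => a b /=; ring. Qed.

Lemma rdotNl x z : rdot (- x) z = - rdot x z.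
Proof. by rewrite /re_dot linearNl /=; case: (dot x z). Qed.

Lemma rdotBl x y z : rdot (x - y) z = rdot x z - rdot y z.
Proof. by rewrite rdotDl rdotNl. Qed.

Lemma rdotDr x y z : rdot z (x + y) = rdot z x + rdot z y.
Proof. by rewrite rdotC rdotDl !(rdotC z). Qed.

Lemma rdotZr r x z : rdot z (r%:C *: x) = r * rdot z x.
Proof. by rewrite rdotC rdotZl rdotC. Qed.

Lemma rdotBr x y z : rdot z (x - y) = rdot z x - rdot z y.
Proof. by rewrite rdotC rdotBl !(rdotC z). Qed.

Lemma rdot_i x y : rdot ('i%C *: x) y = - complex.Im (dot x y).
Proof. by rewrite /re_dot linearZl_LR /=; case: (dot x y) => a b /=; ring. Qed.

(** The scalar 1 compares real parts and the scalar ['i] imaginary parts, so complex identities can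
    be proved through [re_dot]. *)
Lemma dot_eq_rdot x y x' y' : 
  (forall a, rdot (a *: x) y = rdot (a *: x') y') -> dot x y = dot x' y'.
Proof.
move=> h; have := h 1; rewrite !scale1r /re_dot => h1.
have := h 'i%C; rewrite !rdot_i => /oppr_inj h2.
by apply/eqP; rewrite eq_complex h1 h2 !eqxx.
Qed.

Lemma rdot_dot0 x y : dot x y = 0 -> rdot x y = 0.
Proof. by rewrite /re_dot => ->. Qed.

Lemma dot0C x y : dot x y = 0 -> dot y x = 0.
Proof. by move=> h; rewrite hermC /= h rmorph0 mulr0. Qed.

Lemma nrmD2 x y : nrm (x + y) ^+ 2 = nrm x ^+ 2 + 2 * rdot x y + nrm y ^+ 2.
Proof. rewrite -!rdotxx rdotDl !rdotDr (rdotC y x); ring. Qed.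

Lemma nrmB2 x y : nrm (x - y) ^+ 2 = nrm x ^+ 2 - 2 * rdot x y + nrm y ^+ 2.
Proof. rewrite -!rdotxx rdotBl !rdotBr (rdotC y x); ring. Qed.

(** Cauchy-Schwarz follows from the triangle inequality, part of the normed structure: square it and
    compare with [nrmD2]. *)
Lemma rdot_le x y : rdot x y <= nrm x * nrm y.
Proof.
have := nrmD x y; have := nrmD2 x y.
have := nrm_ge0 x; have := nrm_ge0 y; have := nrm_ge0 (x + y).
move: (nrm (x + y)) (nrm x) (nrm y) (rdot x y) => s a b c; nra.
Qed.

Lemma rdot_abs_le x y : `|rdot x y| <= nrm x * nrm y.
Proof.
rewrite ler_norml rdot_le andbT lerNl -rdotNl.
by apply: le_trans (rdot_le _ _) _; rewrite nrmN.
Qed.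

Lemma quad_ge0_linear_eq0 (b c : F) :
  (forall t, 0 <= 2 * t * b + t ^+ 2 * c) -> b = 0.
Proof.
move=> h; apply/eqP/negPn/negP => b0.
have b2 : 0 < b ^+ 2 by rewrite exprn_even_gt0.
have c1 : 0 < `|c| + 1 by rewrite ltr_pwDr // normr_ge0.
(* At this [t] the linear term outweighs the quadratic one, because [c < 2 * (|c| + 1)]. *)
have := h (- b / (`|c| + 1)); apply/negP; rewrite -ltNge.
have -> : 2 * (- b / (`|c| + 1)) * b + (- b / (`|c| + 1)) ^+ 2 * c
   = b ^+ 2 / (`|c| + 1) ^+ 2 * (c - 2 * (`|c| + 1)).
  by field; rewrite gt_eqF.
rewrite pmulr_rlt0; last by rewrite divr_gt0 // exprn_gt0.
have := ler_norm c; lra.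
Qed.

Lemma closureP (A : set H) x :
  closure A x <-> forall e : F, 0 < e -> exists y, A y /\ nrm (x - y) < e.
Proof.
split=> [cl e e0|h B /nbhs_ballP[e /= e0 eB]].
  have /cl : nbhs x (ball x e%:C) by apply: nbhsx_ballx; rewrite ltcR.
  move=> [y [Ay]]; rewrite -ball_normE /= nrmE ltcR => xy.
  by exists y.
have er : e = (complex.Re e)%:C by rewrite RRe_real // gtr0_real.
have e0' : 0 < complex.Re e by rewrite -ltcR -er.
have [y [Ay xy]] := h _ e0'.
exists y; split=> //; apply: eB.
by rewrite -ball_normE /= er nrmE ltcR.
Qed.

Definition seq_cvg (u : nat -> H) x :=
  forall e : F, 0 < e -> exists N, forall n, (N <= n)%N -> nrm (u n - x) < e.

Lemma cauchy_seq_cvg (u : nat -> H) :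
  (forall e : F, 0 < e -> exists N, forall m n, (N <= m)%N -> (N <= n)%N ->
     nrm (u m - u n) < e) -> exists x, seq_cvg u x.
Proof.
move=> h.
have : cvgn u.
  apply: cauchy_cvg; apply/cauchy_ballP => e /= e0.
  have er : e = (complex.Re e)%:C by rewrite RRe_real // gtr0_real.
  have e0' : 0 < complex.Re e by rewrite -ltcR -er.
  have [N hN] := h _ e0'.
  exists (u @` [set n | (N <= n)%N], u @` [set n | (N <= n)%N]) => /=.
    by split; exists N => // n /= Nn; exists n.
  by move=> [_ _] /= [[m Nm <-] [n Nn <-]]; rewrite -ball_normE /= er nrmE ltcR hN.
move=> /cvg_ex[x ux]; exists x => e e0.
have e0' : 0 < e%:C by rewrite ltcR.
move/cvgrPdist_lt : ux => /(_ _ e0')[N _ hN].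
exists N => n Nn; have := hN n Nn.
by rewrite /= distrC nrmE ltcR.
Qed.

Lemma nrm_cvg0 (u : nat -> H) : seq_cvg u 0 ->
  (fun n => `|u n|) @ \oo --> (0 : F[i]^o).
Proof.
move=> h; apply/cvgrPdist_lt => e e0.
have er : e = (complex.Re e)%:C by rewrite RRe_real // gtr0_real.
have e0' : 0 < complex.Re e by rewrite -ltcR -er.
have [N hN] := h _ e0'.
exists N => // n /= Nn; have := hN n Nn.
by rewrite subr0 sub0r normrN normr_id er nrmE ltcR.
Qed.

Definition seq_cluster (u : nat -> H) x :=
  forall e : F, 0 < e -> forall N, exists2 n, (N <= n)%N & nrm (u n - x) < e.

Lemma compact_op_cluster (T : H -> H) (u : nat -> H) : compact_op T ->
  (forall n, nrm (u n) <= 1) -> exists x, seq_cluster (T \o u) x.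
Proof.
rewrite /compact_op precompactE => cT u1.
have [|x [_ hx]] := cT ((T \o u) @ \oo) _.
  by exists 0%N => // n _ /=; apply: subset_closure; exists (u n) => //=;
    rewrite nrmE lecR.
exists x => e e0 N.
have b : nbhs x (ball x e%:C) by apply: nbhsx_ballx; rewrite ltcR.
have bN : ((T \o u) @ \oo) ((T \o u) @` [set n | (N <= n)%N]).
  by exists N => // n /= Nn; exists n.
have [y [[n /= Nn <-]]] := hx _ _ bN b.
by rewrite -ball_normE /= distrC nrmE ltcR => ?; exists n.
Qed.

End RealHilbert.

(** * Riesz representation and Douglas factorization *)

Lemma invS_lt (F : realType) (e : F) : 0 < e ->
  exists N, forall n, (N <= n)%N -> n.+1%:R^-1 < e.
Proof.
move=> e0; have [N _ hN] := near_infty_natSinv_lt (PosNum e0).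
by exists N => n; exact: hN.
Qed.

Lemma le_addM_gt0 (F : realType) (a b k : F) : 0 < k ->
  (forall e, 0 < e -> a <= b + e * k) -> a <= b.
Proof.
move=> k0 h; apply/ler_addgt0Pr => e e0.
by have := h _ (divr_gt0 e0 k0); rewrite divfK // gt_eqF.
Qed.

Section Riesz.
Context (F : realType) (H : completeNormedModType F[i]).
Context (dot : {dot H for conjC}) (hdot : induces_norm dot).
Implicit Types (x y z v w : H) (a : F[i]) (r : F).
Local Notation rdot := (re_dot dot).

Definition subspace (E : set H) :=
  [/\ E 0, forall x y, E x -> E y -> E (x + y) & forall a x, E x -> E (a *: x)].

(* The representing vector is the limit of a minimizing sequence of
   J z = |z|^2 - 2 f z on E, which is Cauchy by the parallelogram law; E need
   not be closed. *)
Lemma riesz_subspace (E : set H) (f : H -> F) (c : F) : subspace E -> 0 <= c ->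
  (forall x y, E x -> E y -> f (x + y) = f x + f y) ->
  (forall r x, E x -> f (r%:C *: x) = r * f x) ->
  (forall x, E x -> f x <= c * nrm x) ->
  exists y, [/\ closure E y, nrm y <= c & forall v, E v -> rdot v y = f v].
Proof.
move=> [E0 ED EZ] c0 fD fZ fc.
pose J z := nrm z ^+ 2 - 2 * f z.
have Jlb z : E z -> - c ^+ 2 <= J z.
  move=> Ez; have := fc _ Ez; rewrite /J; have := nrm_ge0 z.
  have := sqr_ge0 (nrm z - c); nra.
have iJ : has_inf (J @` E).
  by split; [exists (J 0), 0|exists (- c ^+ 2) => _ [z Ez <-]; exact: Jlb].
set m := inf (J @` E).
have Jm z : E z -> m <= J z by move=> Ez; apply: ge_inf; [case: iJ|exists z].
have /choice[u hu] n : exists z, E z /\ J z < m + n.+1%:R^-1.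
  have e0 : 0 < n.+1%:R^-1 :> F by rewrite invr_gt0.
  by have [_ [z Ez <-] Jz] := inf_adherent e0 iJ; exists z.
have uE n : E (u n) by case: (hu n).
(* Parallelogram law; the midpoint of [z] and [w] lies in [E], so [J] is at least [m] there. *)
have par z w e : E z -> E w -> J z < m + e -> J w < m + e ->
    nrm (z - w) ^+ 2 <= 4 * e.
  move=> Ez Ew; have := Jm _ (EZ (2^-1)%:C _ (ED _ _ Ez Ew)).
  rewrite /J nrmZ ?invr_ge0 // exprMn fZ; last exact: ED.
  by rewrite fD // (nrmD2 hdot z w) (nrmB2 hdot); lra.
have [|y uy] := @cauchy_seq_cvg _ _ u.
  move=> e e0; have e4 : 0 < e ^+ 2 / 5 by rewrite divr_gt0 // exprn_gt0.
  have [N hN] := invS_lt e4; exists N => i j Ni Nj.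
  have Ju k : (N <= k)%N -> J (u k) < m + e ^+ 2 / 5.
    by move=> Nk; apply: lt_trans (hu k).2 _; rewrite ltrD2l hN.
  have := par _ _ _ (uE i) (uE j) (Ju _ Ni) (Ju _ Nj).
  rewrite -(@ltr_pXn2r _ 2) ?nnegrE ?nrm_ge0 ?(ltW e0) // => h.
  have := exprn_gt0 2 e0; lra.
have uyJ e : 0 < e -> exists n, [/\ E (u n), J (u n) < m + e & nrm (u n - y) < e].
  move=> e0; have [N1 h1] := invS_lt e0; have [N2 h2] := uy _ e0.
  exists (maxn N1 N2); split=> //; last by apply: h2; rewrite leq_maxr.
  by apply: lt_trans (hu _).2 _; rewrite ltrD2l h1 // leq_maxl.
(* First variation: [m <= J (u n + t v)], and in the limit [2 t (rdot v y - f v) + t^2 |v|^2] is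
   nonnegative for every [t]. *)
have rE v : E v -> rdot v y = f v.
  move=> Ev; apply/eqP; rewrite -subr_eq0; apply/eqP.
  apply: (@quad_ge0_linear_eq0 _ _ (nrm v ^+ 2)) => t.
  have k0 : 0 < 1 + 2 * `|t| * nrm v by rewrite ltr_pwDl // !mulr_ge0 ?nrm_ge0.
  apply: (le_addM_gt0 k0) => e e0.
  have [n [En Jn ne]] := uyJ _ e0.
  have := Jm _ (ED _ _ En (EZ t%:C _ Ev)).
  rewrite /J (nrmD2 hdot) fD //; last exact: EZ.
  rewrite fZ // rdotZr -(rdotxx hdot (_ *: v)) rdotZl rdotZr (rdotxx hdot).
  move: Jn; rewrite /J => Jn.
  have : t * rdot (u n - y) v <= `|t| * nrm v * e.
    apply: le_trans (ler_norm _) _; rewrite normrM -mulrA ler_wpM2l //.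
    apply: le_trans (rdot_abs_le hdot _ _) _.
    by rewrite mulrC ler_wpM2l ?nrm_ge0 // ltW.
  rewrite rdotBl (rdotC dot v y); lra.
exists y; split=> //.
  apply/closureP => e e0; have [n [En _ ne]] := uyJ _ e0.
  by exists (u n); rewrite nrmBC.
(* For the bound on [y]: [|y|^2] is the limit of [rdot (u n) y = f (u n)], which is at most
   [c |u n|]. *)
have [y0|/nrm_gt0 y0] := eqVneq y 0; first by rewrite y0 nrm0.
rewrite -(ler_pM2r y0) -expr2 -(rdotxx hdot).
have k0 : 0 < nrm y + c by rewrite ltr_wpDr.
apply: (le_addM_gt0 k0) => e e0.
have [n [En _ ne]] := uyJ _ e0.
have := fc _ En; rewrite -rE // => h1.
have h2 : c * nrm (u n) <= c * (nrm y + e).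
  rewrite ler_wpM2l // -[u n](subrK y) addrC.
  by apply: le_trans (nrmD _ _) _; rewrite lerD2l ltW.
have h3 : rdot (y - u n) y <= e * nrm y.
  apply: le_trans (rdot_le hdot _ _) _.
  by rewrite ler_wpM2r ?nrm_ge0 // nrmBC ltW.
by move: h3; rewrite rdotBl; lra.
Qed.

Lemma dot_inj x y : (forall v, dot v x = dot v y) -> x = y.
Proof.
move=> h; apply/eqP; rewrite -subr_eq0; apply/eqP/nrm_eq0/eqP.
by rewrite -(@sqrf_eq0 _ (nrm _)) -(rdotxx hdot) rdotBr /re_dot h subrr.
Qed.

Lemma rdot0_dot0 x y : (forall a, rdot (a *: x) y = 0) -> dot x y = 0.
Proof.
move=> h; rewrite -(linear0l dot y); apply: dot_eq_rdot => a.
by rewrite h scaler0 /re_dot linear0l.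
Qed.

(** The projection is the Riesz vector of [re_dot ^~ x] on [E]. Stability of [E] under complex
    scalars upgrades real orthogonality to [dot]. *)
Lemma exists_orth_proj (E : set H) x : subspace E -> closure E `<=` E ->
  exists q, E q /\ orthc dot E (x - q).
Proof.
move=> sE clE; case: (sE) => _ _ EZ.
have [||||q [Eq _ qE]] := @riesz_subspace E (rdot ^~ x) (nrm x) sE.
- exact: nrm_ge0.
- by move=> *; rewrite rdotDl.
- by move=> *; rewrite rdotZl.
- by move=> z _; rewrite mulrC rdot_le.
exists q; split; first exact: clE.
move=> v Ev; apply: dot0C; apply: rdot0_dot0 => a.
by rewrite rdotBr qE ?subrr //; exact: EZ.
Qed.

Lemma orth_projP (E : set H) x : subspace E -> closure E `<=` E ->
  E (orth_proj dot E x) /\ orthc dot E (x - orth_proj dot E x).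
Proof.
move=> sE clE; have [q hq] := exists_orth_proj x sE clE.
by apply: (@getPex _ [set q | E q /\ orthc dot E (x - q)]); exists q.
Qed.

(* The form |x|^2 - |T x|^2 is nonnegative and vanishes at z. *)
Lemma isometric_at_dot (T : {linear H -> H}) z :
  (forall x, nrm (T x) <= nrm x) -> nrm (T z) = nrm z ->
  forall v, dot (T v) (T z) = dot v z.
Proof.
move=> Tc Tz v; apply: dot_eq_rdot => a; rewrite -linearZ /=.
move: (a *: v) => {v a} v; apply/esym/eqP; rewrite -subr_eq0; apply/eqP.
apply: (@quad_ge0_linear_eq0 _ _ (nrm v ^+ 2 - nrm (T v) ^+ 2)) => t.
have : nrm (T (z + t%:C *: v)) ^+ 2 <= nrm (z + t%:C *: v) ^+ 2.
  by rewrite ler_pXn2r ?nnegrE ?nrm_ge0.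
rewrite linearD linearZ /= !(nrmD2 hdot) !rdotZr -!(rdotxx hdot (_ *: _)).
rewrite !rdotZl !rdotZr !(rdotxx hdot) Tz (rdotC dot z) (rdotC dot (T z)); lra.
Qed.

(** Otherwise there would be [u n] in the unit ball with [T (u n)] of norm above [n], and these
    images could not cluster. *)
Lemma compact_op_bounded (T : {linear H -> H}) : compact_op T ->
  exists C, 0 < C /\ forall x, nrm (T x) <= C * nrm x.
Proof.
move=> cT; have [C hC] : exists C : nat, forall x, nrm x <= 1 -> nrm (T x) <= C%:R.
  apply/not_existsP => h.
  have /choice[u hu] n : exists x, nrm x <= 1 /\ n%:R < nrm (T x).
    have /existsNP[x /not_implyP[x1 /negP]] := h n.
    by rewrite -ltNge => ?; exists x.
  have [|w hw] := compact_op_cluster (u := u) cT; first by move=> n; case: (hu n).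
  have [N hN] : exists N : nat, nrm w + 1 < N%:R.
    by exists (truncn (nrm w + 1)).+1; rewrite truncnS_gt.
  have [n Nn /= nw] := hw 1 ltr01 N.
  have := (hu n).2; have : N%:R <= n%:R :> F by rewrite ler_nat.
  have := nrmD (T (u n) - w) w; rewrite subrK; lra.
exists (C%:R + 1); split; first by rewrite ltr_wpDl.
move=> x; have [->|x0] := eqVneq x 0; first by rewrite linear0 nrm0 mulr0.
have n0 := nrm_gt0 x0.
have := hC ((nrm x)^-1%:C *: x).
rewrite linearZ /= !nrmZ ?invr_ge0 ?nrm_ge0 // mulVf ?gt_eqF // => /(_ (lexx _)).
rewrite ler_pdivrMl // => h; apply: le_trans h _.
by rewrite mulrC ler_wpM2r ?nrm_ge0 // lerDl.
Qed.

Lemma eigspace_subspace (T : {linear H -> H}) a : subspace (eigspace T a).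
Proof.
split; rewrite /eigspace /ker_op /=; first by rewrite linear0 scaler0 subrr.
  by move=> x y /subr0_eq hx /subr0_eq hy; rewrite linearD hx hy scalerDr subrr.
by move=> b x /subr0_eq hx; rewrite linearZ /= hx !scalerA mulrC subrr.
Qed.

Lemma eigspace_closed (T : {linear H -> H}) a C :
  0 < C -> (forall x, nrm (T x) <= C * nrm x) ->
  closure (eigspace T a) `<=` eigspace T a.
Proof.
move=> C0 hC x /closureP cl; rewrite /eigspace /ker_op /=.
apply: nrm_eq0; apply/eqP; rewrite eq_le nrm_ge0 andbT.
have a0 : 0 <= complex.Re `|a| by rewrite Re_norm_ge0.
have k0 : 0 < C + complex.Re `|a| by rewrite ltr_pwDl.
apply: (le_addM_gt0 k0) => e e0; rewrite add0r.
have [y [/subr0_eq Ty xy]] := cl _ e0.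
have -> : T x - a *: x = T (x - y) - a *: (x - y).
  by rewrite linearB /= Ty scalerBr opprB addrA subrK.
apply: le_trans (nrmD _ _) _; rewrite nrmN mulrDr lerD //.
  by apply: le_trans (hC _) _; rewrite mulrC ler_pM2r // ltW.
by rewrite nrmZc mulrC ler_wpM2r // ltW.
Qed.

(** Pythagoras for the splitting of [x] along [ker_op V], which is closed by continuity, and its
    complement, on which [V] is isometric. *)
Lemma partial_isometry_contraction (V : {linear H -> H}) :
  partial_isometry dot V -> forall x, nrm (V x) <= nrm x.
Proof.
move=> [Vc Vi] x.
have sK : subspace (ker_op V).
  split; rewrite /ker_op /=; first by rewrite linear0.
    by move=> y z; rewrite linearD => -> ->; rewrite addr0.
  by move=> a y; rewrite linearZ /= => ->; rewrite scaler0.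
have cK : closure (ker_op V) `<=` ker_op V.
  move=> y; apply: (@preimage_closed _ _ V [set 0]); first by move=> z _; exact: Vc.
  exact: accessible_closed_set1 (hausdorff_accessible (@norm_hausdorff _ _)) _.
have [q [Kq qx]] := exists_orth_proj x sK cK.
have -> : V x = V (x - q) by rewrite linearB /= Kq subr0.
have := Vi _ qx; rewrite !nrmE => /complexI ->.
rewrite -(@ler_pXn2r _ 2) ?nnegrE ?nrm_ge0 //.
have := nrmD2 hdot (x - q) q; rewrite subrK (rdot_dot0 (qx _ Kq)) mulr0 addr0 => ->.
by rewrite lerDl sqr_ge0.
Qed.

End Riesz.

Section Douglas.
Context (F : realType) (H : completeNormedModType F[i]).
Context (dot : {dot H for conjC}) (hdot : induces_norm dot).
Implicit Types (x y z v w : H) (a : F[i]) (r : F).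
Local Notation rdot := (re_dot dot).
Context (R R1 : {linear H -> H}).
Hypotheses (Rsa : selfadjoint dot R) (R1sa : selfadjoint dot R1).
Hypotheses (Rker : ker_op R = [set 0]) (R1R : forall x, nrm (R1 x) <= nrm (R x)).

Lemma ker0_inj : injective R.
Proof.
move=> x y h; apply/eqP; rewrite -subr_eq0; apply/eqP.
have : ker_op R (x - y) by rewrite /ker_op /= linearB /= h subrr.
by rewrite Rker.
Qed.

Lemma op_invK : cancel R (op_inv R).
Proof.
move=> z; apply: ker0_inj.
by apply: (@getPex _ [set x | R x = R z]); exists z.
Qed.

Lemma range_subspace : subspace (range R).
Proof.
split; first by exists 0; rewrite ?linear0.
  by move=> _ _ [x _ <-] [y _ <-]; exists (x + y); rewrite ?linearD.
by move=> a _ [x _ <-]; exists (a *: x); rewrite ?linearZ.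
Qed.

(** The Riesz vector [y] of [re_dot ^~ x] on the range lies in its closure and satisfies
    [R x = R y], hence equals [x]. *)
Lemma range_dense x : closure (range R) x.
Proof.
have [|||y [cy _ hy]] :=
  @riesz_subspace _ _ _ hdot (range R) (rdot ^~ x) (nrm x) range_subspace (nrm_ge0 x).
- by move=> *; rewrite rdotDl.
- by move=> *; rewrite rdotZl.
- by move=> z _; rewrite mulrC rdot_le.
suff -> : x = y by [].
apply: ker0_inj; apply: (dot_inj hdot) => z; rewrite -!Rsa.
by apply: dot_eq_rdot => a; rewrite -linearZ hy.
Qed.

(** The functional sending [R v] to [rdot (R1 v) x] is well defined by injectivity and bounded by
    [nrm x] by [R1R]; [y] represents it. *)
Lemma douglas_factor x : exists y, nrm y <= nrm x /\ R y = R1 x.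
Proof.
have [|||y [_ yx hy]] := @riesz_subspace _ _ _ hdot (range R)
   (fun y => rdot (R1 (op_inv R y)) x) (nrm x) range_subspace (nrm_ge0 x).
- move=> _ _ [v _ <-] [w _ <-].
  by rewrite -linearD !op_invK linearD rdotDl.
- move=> r _ [v _ <-].
  by rewrite -linearZ !op_invK linearZ rdotZl.
- move=> _ [v _ <-]; rewrite op_invK mulrC.
  by apply: le_trans (rdot_le hdot _ _) _; rewrite ler_wpM2r ?nrm_ge0.
exists y; split=> //; apply: (dot_inj hdot) => z; rewrite -Rsa -R1sa.
by apply: dot_eq_rdot => a; rewrite -!linearZ hy ?op_invK //; exists (a *: z).
Qed.

(** The default value in [contr_ext] is never taken: the Douglas factor [B] with [R B = R1] is a
    linear contraction, and its adjoint is the required extension. *)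
Lemma contr_ext_spec :
  [/\ linear (contr_ext R1 R), forall x, nrm (contr_ext R1 R x) <= nrm x &
      forall z, contr_ext R1 R (R z) = R1 z].
Proof.
set S := [set A : H -> H | [/\ linear A, forall x, `|A x| <= `|x| &
        forall y, range R y -> A y = R1 (op_inv R y)]].
suff [A SA] : exists A, S A.
  have [Al Ac AR] : S (contr_ext R1 R) by apply: (@xgetPex _ _ S); exists A.
  split=> // [x|z]; first by rewrite -le_nrm.
  by rewrite AR ?op_invK //; exists z.
have /choice[B hB] := douglas_factor.
have BD a x y : B (a *: x + y) = a *: B x + B y.
  by apply: ker0_inj; rewrite linearP !(hB _).2 linearP.
have BZ a x : B (a *: x) = a *: B x.
  by apply: ker0_inj; rewrite linearZ !(hB _).2 linearZ.
have sT : subspace [set: H] by [].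
(* [A] is the adjoint of [B], obtained from Riesz on the whole space. *)
have /choice[A hA] w : exists y, nrm y <= nrm w /\ forall v, dot v y = dot (B v) w.
  have [|||y [_ yw hy]] := @riesz_subspace _ _ _ hdot setT
     (fun v => rdot (B v) w) (nrm w) sT (nrm_ge0 w).
  - by move=> x y _ _; rewrite -[x]scale1r BD !scale1r rdotDl.
  - by move=> r x _; rewrite BZ rdotZl.
  - move=> x _; rewrite mulrC; apply: le_trans (rdot_le hdot _ _) _.
    by rewrite ler_wpM2r ?nrm_ge0 //; case: (hB x).
  exists y; split=> // v; apply: dot_eq_rdot => a.
  by rewrite hy // BZ.
exists A; split.
- move=> a x y; apply: (dot_inj hdot) => v.
  by rewrite linearPr !(hA _).2 linearPr /= !(hA _).2.
- by move=> x; rewrite le_nrm; case: (hA x).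
- move=> _ [z _ <-]; rewrite op_invK; apply: (dot_inj hdot) => v.
  by rewrite (hA _).2 -Rsa (hB v).2 R1sa.
Qed.

End Douglas.

(** * Recurrent vectors of a contraction *)

Section Recurrent.
Context (F : realType) (H : completeNormedModType F[i]).
Implicit Types (x y z v w : H) (a : F[i]).
Context (T : {linear H -> H}) (Tc : forall x, nrm (T x) <= nrm x).

Lemma iter_linD k x y : iter k T (x + y) = iter k T x + iter k T y.
Proof. by elim: k => //= k ->; rewrite linearD. Qed.

Lemma iter_linZ k a x : iter k T (a *: x) = a *: iter k T x.
Proof. by elim: k => //= k ->; rewrite linearZ. Qed.

Lemma iter_linB k x y : iter k T (x - y) = iter k T x - iter k T y.
Proof. by rewrite iter_linD -scaleN1r iter_linZ scaleN1r. Qed.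

Lemma iter_contraction k x : nrm (iter k T x) <= nrm x.
Proof. by elim: k => //= k IH; exact: le_trans (Tc _) IH. Qed.

(** Fixing the return times [n] in advance is what makes this set closed under sums. *)
Definition recurrent (n : nat -> nat) : set H :=
  [set x | seq_cvg (fun j => iter (n j) T x) x].

Lemma cluster_recurrent y w : seq_cluster (fun k => iter k T y) w ->
  exists2 n, (forall j, (0 < n j)%N) & recurrent n w.
Proof.
move=> hw.
have /choice[n hn] j : exists n, (0 < n)%N /\ nrm (iter n T w - w) < j.+1%:R^-1.
  have e0 : 0 < j.+1%:R^-1 / 2 :> F by rewrite divr_gt0 // invr_gt0.
  have [m1 _ h1] := hw _ e0 0%N; have [m2 m12 h2] := hw _ e0 m1.+1.
  (* T^(m2 - m1) moves T^m1 y, which is close to w, to T^m2 y. *)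
  exists (m2 - m1)%N; split; first by rewrite subn_gt0.
  apply: le_lt_trans (nrm_dist _ (iter m2 T y) _) _.
  rewrite [ltRHS]splitr ltrD // -{2}(subnK (ltnW m12)) iterD -iter_linB.
  by apply: le_lt_trans (iter_contraction _ _) _; rewrite nrmBC.
exists n; first by move=> j; case: (hn j).
move=> e e0; have [N hN] := invS_lt e0; exists N => j Nj.
exact: lt_trans (hn j).2 (hN _ Nj).
Qed.

Context (n : nat -> nat) (n_gt0 : forall j, (0 < n j)%N).
Local Notation M := (recurrent n).

Lemma recurrent_subspace : subspace M.
Proof.
split.
- move=> e e0; exists 0%N => j _; rewrite subr0.
  by apply: le_lt_trans (iter_contraction _ _) _; rewrite nrm0.
- move=> x y hx hy e e0; have e2 : 0 < e / 2 by rewrite divr_gt0.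
  have [N1 h1] := hx _ e2; have [N2 h2] := hy _ e2.
  exists (maxn N1 N2) => j; rewrite geq_max => /andP[j1 j2].
  rewrite iter_linD opprD addrACA; apply: le_lt_trans (nrmD _ _) _.
  by rewrite [ltRHS]splitr ltrD ?h1 ?h2.
- move=> a x hx e e0; have k0 : 0 < complex.Re `|a| + 1.
    by rewrite ltr_wpDl ?Re_norm_ge0.
  have [N hN] := hx _ (divr_gt0 e0 k0); exists N => j /hN.
  rewrite iter_linZ -scalerBr nrmZc ltr_pdivlMr // => h.
  by apply: le_lt_trans h; rewrite mulrC ler_wpM2l ?nrm_ge0 // lerDl.
Qed.

Lemma recurrent_closed : closure M `<=` M.
Proof.
move=> x /closureP hx e e0; have e3 : 0 < e / 3 by rewrite divr_gt0.
have [y [My xy]] := hx _ e3; have [N hN] := My _ e3.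
exists N => j /hN h; apply: le_lt_trans (nrm_dist _ (iter (n j) T y) _) _.
rewrite -iter_linB; have := iter_contraction (n j) (x - y).
have := nrm_dist (iter (n j) T y) y x; rewrite (nrmBC y x); lra.
Qed.

Lemma recurrent_invariant x : M x -> M (T x).
Proof.
move=> hx e e0; have [N hN] := hx _ e0; exists N => j /hN.
by rewrite -iterSr iterS -linearB; apply: le_lt_trans; exact: Tc.
Qed.

Lemma recurrent_iter k x : M x -> M (iter k T x).
Proof. by move=> Mx; elim: k => //= k; exact: recurrent_invariant. Qed.

(** The iterates at times [n j] tend to [x], yet their norms are at most [nrm (T x)] since [n j] is
    positive. *)
Lemma recurrent_isometric x : M x -> nrm (T x) = nrm x.
Proof.
move=> hx; apply/eqP; rewrite eq_le Tc /=; apply: (@le_addM_gt0 _ _ _ 1) => // e e0.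
have [N /(_ N (leqnn _))] := hx _ e0; rewrite mulr1 => h.
rewrite -(prednK (n_gt0 N)) iterSr in h.
have := iter_contraction (n N).-1 (T x).
have := nrmD (x - iter (n N).-1 T (T x)) (iter (n N).-1 T (T x)).
by rewrite subrK nrmBC; lra.
Qed.

(** A preimage is the limit of the iterates of [x] at times [n j - 1]: [T] is isometric on their
    differences, so they are Cauchy because their images are. *)
Lemma recurrent_surj x : M x -> exists2 z, M z & T z = x.
Proof.
move=> hx; have [_ MD MZ] := recurrent_subspace.
pose u j := iter (n j).-1 T x.
have Tu j : T (u j) = iter (n j) T x by rewrite /u -iterS prednK.
have Mu j : M (u j) by exact: recurrent_iter.
have [|z uz] := @cauchy_seq_cvg _ _ u.
  move=> e e0; have e2 : 0 < e / 2 by rewrite divr_gt0.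
  have [N hN] := hx _ e2; exists N => i j Ni Nj.
  have Mij : M (u i - u j) by rewrite -scaleN1r; apply: MD => //; exact: MZ.
  rewrite -(recurrent_isometric Mij) linearB /= !Tu.
  apply: le_lt_trans (nrm_dist _ x _) _.
  by rewrite [ltRHS]splitr ltrD ?hN // nrmBC hN.
exists z.
  apply: recurrent_closed; apply/closureP => e e0.
  have [N /(_ N (leqnn _)) h] := uz _ e0.
  by exists (u N); rewrite nrmBC.
apply/eqP; rewrite -subr_eq0; apply/eqP/nrm_eq0/eqP; rewrite eq_le nrm_ge0 andbT.
apply: (@le_addM_gt0 _ _ _ 2) => // e e0.
have [N1 h1] := uz _ e0; have [N2 h2] := hx _ e0.
have := h1 (maxn N1 N2) (leq_maxl _ _); have := h2 (maxn N1 N2) (leq_maxr _ _).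
set j := maxn _ _; rewrite -Tu => h3 h4.
have := nrm_dist (T z) (T (u j)) x; have := Tc (z - u j).
by rewrite linearB /= nrmBC in h4 *; lra.
Qed.

End Recurrent.

(** * Monotonicity of [nrm (R z)] along recurrent orbits, and eigenvectors of [R] among recurrent
    vectors *)

Section Lyapunov.
Context (F : realType) (H : completeNormedModType F[i]).
Context (dot : {dot H for conjC}) (hdot : induces_norm dot).
Implicit Types (x y z v w : H) (a : F[i]).
Local Notation rdot := (re_dot dot).
Context (R R1 : {linear H -> H}) (p : H).
Hypotheses (Rcomp : compact_op R).
Hypotheses (Rsa : selfadjoint dot R) (R1sa : selfadjoint dot R1).
Hypothesis Rge0 : nonneg_op dot R.
Hypothesis Rker : ker_op R = [set 0].
Hypothesis hp : forall x, R (R x) - R1 (R1 x) = dot x p *: p.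

(** Pair the identity [hp] at [v] with [v]; the bracket is the squared modulus of [dot v p]. *)
Lemma nrm_rank_one v : nrm (R v) ^+ 2 =
  nrm (R1 v) ^+ 2 + (complex.Re (dot v p) ^+ 2 + complex.Im (dot v p) ^+ 2).
Proof.
have : rdot (R (R v) - R1 (R1 v)) v = rdot (dot v p *: p) v by rewrite hp.
rewrite rdotBl /re_dot Rsa R1sa -!/(re_dot dot _ _) !(rdotxx hdot).
rewrite /re_dot linearZl_LR /= (hermC dot p v) /= expr0 mul1r.
by case: (dot v p) => b c /=; lra.
Qed.

Lemma nrm_R1_le v : nrm (R1 v) <= nrm (R v).
Proof.
rewrite -(@ler_pXn2r _ 2) ?nnegrE ?nrm_ge0 // nrm_rank_one lerDl.
by rewrite addr_ge0 ?sqr_ge0.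
Qed.

Lemma dot_p_eq0 v : nrm (R v) <= nrm (R1 v) -> dot v p = 0.
Proof.
rewrite -(@ler_pXn2r _ 2) ?nnegrE ?nrm_ge0 // nrm_rank_one.
rewrite gerDl => h; apply/eqP; rewrite eq_complex /=.
have := sqr_ge0 (complex.Re (dot v p)); have := sqr_ge0 (complex.Im (dot v p)).
by move=> h1 h2; apply/andP; split; rewrite -sqrf_eq0; apply/eqP; lra.
Qed.

(** The defect [d = S x - l x] satisfies [S d = - l d], which nonnegativity of [S] allows only for
    [d = 0]. *)
Lemma nonneg_sq_eig (S : {linear H -> H}) (l : F) x : nonneg_op dot S -> 0 < l ->
  S (S x) = (l ^+ 2)%:C *: x -> S x = l%:C *: x.
Proof.
move=> Sge0 l0 hx; apply/eqP; rewrite -subr_eq0; apply/eqP.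
set d := S x - l%:C *: x.
have Sd : S d = - (l%:C *: d).
  rewrite /d linearB linearZ /= hx scalerBr scalerA -rmorphM /= -expr2.
  by rewrite opprB.
apply/nrm_eq0/eqP; rewrite -sqrf_eq0 -(rdotxx hdot).
have : 0 <= rdot (S d) d by have := Sge0 d; rewrite lecE => /andP[].
rewrite Sd rdotNl rdotZl (rdotxx hdot) oppr_ge0 pmulr_rle0 // => h.
by rewrite eq_le h sqr_ge0.
Qed.

Context (T : {linear H -> H}) (Tc : forall x, nrm (T x) <= nrm x).
Context (W : H -> H) (Wc : forall x, nrm (W x) <= nrm x).
Hypothesis TR : forall x, T (R x) = R1 (W x).
Context (n : nat -> nat) (n_gt0 : forall j, (0 < n j)%N).
Local Notation M := (recurrent T n).

(** By [TR] the left side is the real part of [dot (T (R (R z))) (T z)], and [T] preserves inner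
    products with [z]. *)
Lemma rdot_W z : M z -> rdot (W (R z)) (R1 (T z)) = nrm (R z) ^+ 2.
Proof.
move=> Mz; have iz := isometric_at_dot hdot Tc (recurrent_isometric Tc n_gt0 Mz).
rewrite -(rdotxx hdot) /re_dot -R1sa -TR iz Rsa //.
Qed.

Lemma nrm_R1T_ge z : M z -> nrm (R z) <= nrm (R1 (T z)).
Proof.
move=> Mz; have [->|/nrm_gt0 h] := eqVneq (R z) 0; first by rewrite nrm0 nrm_ge0.
rewrite -(ler_pM2l h) -expr2 -(rdot_W Mz).
by apply: le_trans (rdot_le hdot _ _) _; rewrite ler_wpM2r ?nrm_ge0.
Qed.

(** Along the orbit [nrm (R _)] does not decrease, but recurrence brings it back arbitrarily close
    to [nrm (R z)]; so it is constant. *)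
Lemma nrm_RT z : M z -> nrm (R (T z)) = nrm (R z).
Proof.
move=> Mz; have [C [C0 hC]] := compact_op_bounded Rcomp.
have mono w : M w -> nrm (R w) <= nrm (R (T w)).
  by move=> Mw; apply: le_trans (nrm_R1T_ge Mw) (nrm_R1_le _).
apply/eqP; rewrite eq_le mono // andbT.
apply: (le_addM_gt0 C0) => e e0.
have [N /(_ N (leqnn _)) h] := Mz _ e0.
have hk k : nrm (R (T z)) <= nrm (R (iter k T (T z))).
  elim: k => //= k IH; apply: le_trans IH (mono _ _).
  exact/recurrent_iter/recurrent_invariant.
have := hk (n N).-1; rewrite -iterSr prednK // => h1.
have := nrmD (R (iter (n N) T z) - R z) (R z); rewrite subrK -linearB /=.
have := hC (iter (n N) T z - z).
have : C * nrm (iter (n N) T z - z) <= e * C by rewrite mulrC ler_pM2r // ltW.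
lra.
Qed.

Lemma recurrent_orth x : M x -> dot x p = 0.
Proof.
move=> /(recurrent_surj Tc n_gt0)[z Mz <-]; apply: dot_p_eq0.
by rewrite nrm_RT // nrm_R1T_ge.
Qed.

(** Equality in Cauchy-Schwarz gives [W (R z) = R1 (T z)], so [T R^2 z = R1^2 T z]; this is
    [R^2 T z] because [T z] is orthogonal to [p]. *)
Lemma recurrent_comm z : M z -> R (R (T z)) = T (R (R z)).
Proof.
move=> Mz; have MTz := recurrent_invariant Tc Mz.
have e1 : nrm (R1 (T z)) = nrm (R z).
  apply/eqP; rewrite eq_le nrm_R1T_ge // andbT -(nrm_RT Mz); exact: nrm_R1_le.
have -> : T (R (R z)) = R1 (R1 (T z)).
  rewrite TR; congr (R1 _); apply/eqP; rewrite -subr_eq0; apply/eqP/nrm_eq0/eqP.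
  rewrite -sqrf_eq0 eq_le sqr_ge0 andbT (nrmB2 hdot) rdot_W // e1.
  have : nrm (W (R z)) ^+ 2 <= nrm (R z) ^+ 2.
    by rewrite ler_pXn2r ?nnegrE ?nrm_ge0.
  lra.
by apply/eqP; rewrite -subr_eq0 hp recurrent_orth // scale0r.
Qed.

Lemma recurrent_R2 z : M z -> M (R (R z)).
Proof.
move=> Mz; have [C [C0 hC]] := compact_op_bounded Rcomp.
have comm k : iter k T (R (R z)) = R (R (iter k T z)).
  by elim: k => //= k ->; rewrite recurrent_comm //; exact: recurrent_iter.
move=> e e0; have [N hN] := Mz _ (divr_gt0 e0 (mulr_gt0 C0 C0)).
exists N => j /hN; rewrite comm -!linearB /= ltr_pdivlMr ?mulr_gt0 // => h.
apply: le_lt_trans h; apply: le_trans (hC _) _.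
by rewrite mulrCA ler_pM2l // mulrC hC.
Qed.

(** The eigenvalue is the norm of [R] on [M], and compactness makes it attained. Since it is [R^2]
    that is known to preserve [M], the argument yields an eigenvector of [R^2], and [nonneg_sq_eig]
    takes the root. *)
Lemma recurrent_eigenvector x0 : M x0 -> x0 != 0 ->
  exists (l : F) x, [/\ 0 < l, M x, x != 0 & R x = l%:C *: x].
Proof.
move=> Mx0 x0n; have [C [C0 hC]] := compact_op_bounded Rcomp.
have [M0 MD MZ] := recurrent_subspace Tc n.
pose B := [set x | M x /\ nrm x <= 1].
have iS : has_sup [set nrm (R x) | x in B].
  split; first by exists (nrm (R 0)), 0 => //; split; rewrite ?nrm0 ?ler01.
  exists C => _ [x [_ x1] <-]; apply: le_trans (hC _) _.
  by rewrite ler_piMr // ltW.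
set l := sup [set nrm (R x) | x in B].
have lB x : B x -> nrm (R x) <= l by move=> Bx; apply: ub_le_sup; [case: iS|exists x].
have lM x : M x -> nrm (R x) <= l * nrm x.
  move=> Mx; have [->|/nrm_gt0 x0'] := eqVneq x 0; first by rewrite linear0 !nrm0 mulr0.
  have := lB ((nrm x)^-1%:C *: x).
  rewrite linearZ /= nrmZ ?invr_ge0 ?nrm_ge0 // ler_pdivrMl // mulrC; apply.
  split; first exact: MZ.
  by rewrite nrmZ ?invr_ge0 ?nrm_ge0 // mulVf // gt_eqF.
have l0 : 0 < l.
  have Rx0 : R x0 != 0.
    apply/eqP => h; have : ker_op R x0 by [].
    by rewrite Rker => /eqP; apply/negP.
  have := lM _ Mx0; have := nrm_gt0 Rx0; have := nrm_gt0 x0n.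
  by move=> h1 h2 h3; rewrite -(pmulr_lgt0 _ h1); exact: lt_le_trans h2 h3.
(* A maximizing sequence u_j satisfies R^2 u_j - l^2 u_j -> 0, so it converges
   along any subsequence on which R u_j does. *)
have key x : B x ->
    nrm (R (R x) - (l ^+ 2)%:C *: x) ^+ 2 <= 2 * l ^+ 2 * (l ^+ 2 - nrm (R x) ^+ 2).
  move=> [Mx x1]; have MR := recurrent_R2 Mx.
  (* Here [R x] need not be known to lie in [M]: the bound [lM] is applied to [R (R x)], after
     moving one [R] across the inner product. *)
  have R2 : nrm (R (R x)) <= l ^+ 2.
    have [->|/nrm_gt0 h] := eqVneq (R (R x)) 0; first by rewrite nrm0 sqr_ge0.
    rewrite -(ler_pM2r h) -expr2 -(rdotxx hdot) /re_dot Rsa.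
    apply: le_trans (rdot_le hdot _ _) _; rewrite expr2 -mulrA.
    by rewrite ler_pM ?nrm_ge0 // ?lB // lM.
  rewrite (nrmB2 hdot) rdotZr nrmZ ?sqr_ge0 //.
  have -> : rdot (R (R x)) x = nrm (R x) ^+ 2 by rewrite /re_dot Rsa -(rdotxx hdot).
  have : nrm (R (R x)) ^+ 2 <= (l ^+ 2) ^+ 2.
    by rewrite ler_pXn2r ?nnegrE ?nrm_ge0 ?sqr_ge0.
  have : (l ^+ 2 * nrm x) ^+ 2 <= (l ^+ 2) ^+ 2.
    have l2 := sqr_ge0 l; rewrite ler_pXn2r ?nnegrE //; first exact: ler_piMr.
    by apply: mulr_ge0 => //; exact: nrm_ge0.
  lra.
have /choice[u hu] j : exists x, B x /\ l - j.+1%:R^-1 < nrm (R x).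
  have e0 : 0 < j.+1%:R^-1 :> F by rewrite invr_gt0.
  by have [_ [x Bx <-] h] := sup_adherent e0 iS; exists x.
have [|w hw] := compact_op_cluster (u := u) Rcomp; first by move=> j; case: (hu j) => -[].
(* If [R (u j)] is close to [w], then [R^2 (u j)] is close to [R w], and so is [l^2 (u j)] by
   [key]. *)
pose x := (l ^- 2)%:C *: R w.
have xw : (l ^+ 2)%:C *: x = R w.
  by rewrite /x scalerA -rmorphM /= mulfV ?scale1r // expf_neq0 // gt_eqF.
have near e : 0 < e -> exists y, [/\ B y, l - e < nrm (R y) & nrm (y - x) < e].
  move=> e0; have l2 : 0 < l ^+ 2 by rewrite exprn_gt0.
  (* With this [d], [key] bounds the squared defect by [4/17 * l^4 e^2], below the square of
     [l^2 e / 2]; any constant above 16 would do. *)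
  pose d := Num.min e (l * e ^+ 2 / 17).
  have d0 : 0 < d by rewrite lt_min e0 !mulr_gt0 ?exprn_gt0 ?invr_gt0.
  have [N hN] := invS_lt d0.
  have k0 : 0 < l ^+ 2 * e / (2 * C) by rewrite !(mulr_gt0, invr_gt0).
  have [j Nj /= hj] := hw _ k0 N.
  have [Bj lj] := hu j; exists (u j).
  have dj : l - nrm (R (u j)) < d.
    by rewrite ltrBlDl -ltrBlDr; apply: lt_trans lj; rewrite ltrD2l ltrN2 hN.
  move: (dj); rewrite lt_min => /andP[dj1 dj2].
  split=> //; first by lra.
  have -> : nrm (u j - x) = l ^- 2 * nrm ((l ^+ 2)%:C *: (u j - x)).
    by rewrite nrmZ ?(ltW l2) // mulKf // gt_eqF.
  rewrite ltr_pdivrMl // scalerBr xw.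
  apply: le_lt_trans (nrm_dist _ (R (R (u j))) _) _.
  rewrite [ltRHS]splitr ltr_leD //.
    rewrite nrmBC -(@ltr_pXn2r _ 2) ?nnegrE ?nrm_ge0 //; last first.
      by rewrite !mulr_ge0 ?invr_ge0 // ltW.
    apply: le_lt_trans (key _ Bj) _.
    have b1 : nrm (R (u j)) <= l by exact: lB.
    have b2 := nrm_ge0 (R (u j)).
    have b3 : l ^+ 2 - nrm (R (u j)) ^+ 2 <= 2 * l * (l - nrm (R (u j))).
      have := sqr_ge0 (l - nrm (R (u j))); lra.
    have b4 : l ^+ 2 - nrm (R (u j)) ^+ 2 <= 2 * l * (l * e ^+ 2 / 17).
      by apply: le_trans b3 _; rewrite ler_pM2l ?mulr_gt0 // ltW.
    have b5 : 2 * l ^+ 2 * (l ^+ 2 - nrm (R (u j)) ^+ 2)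
        <= 2 * l ^+ 2 * (2 * l * (l * e ^+ 2 / 17)).
      by rewrite ler_pM2l ?mulr_gt0.
    apply: le_lt_trans b5 _.
    have : 0 < l ^+ 2 * l ^+ 2 * e ^+ 2 by rewrite !mulr_gt0 // exprn_gt0.
    lra.
  rewrite -linearB /=; apply: le_trans (hC _) _.
  by have := ltW hj; rewrite -ler_pdivlMl //; congr (_ <= _); field; rewrite gt_eqF.
have Mx : M x.
  apply: (recurrent_closed Tc); apply/closureP => e /near[y [[My _] _ h]].
  by exists y; rewrite nrmBC.
have Bx : B x.
  split=> //; apply: (@le_addM_gt0 _ _ _ 1) => // e /near[y [[_ y1] _ h]].
  by have := nrmD (x - y) y; rewrite subrK nrmBC; lra.
have Rxl : l <= nrm (R x).
  have k0 : 0 < C + 1 by rewrite ltr_wpDl ?ltW.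
  apply: (le_addM_gt0 k0) => e e0; have [y [_ h1 h2]] := near _ e0.
  have := nrmD (R y - R x) (R x); rewrite subrK -linearB /=.
  have := hC (y - x); have : C * nrm (y - x) <= C * e by rewrite ler_pM2l // ltW.
  lra.
exists l, x; split=> //.
  apply/eqP => x0'; move: Rxl; rewrite x0' linear0 nrm0; lra.
apply: nonneg_sq_eig => //; apply/eqP; rewrite -subr_eq0; apply/eqP/nrm_eq0/eqP.
rewrite -sqrf_eq0 eq_le sqr_ge0 andbT; apply: le_trans (key _ Bx) _.
by rewrite pmulr_rle0 ?mulr_gt0 ?exprn_gt0 // subr_le0 ler_pXn2r ?nnegrE ?nrm_ge0 ?(ltW l0).
Qed.

Lemma recurrent_eig_invariant (l : F) x : 0 < l -> M x -> R x = l%:C *: x ->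
  R (T x) = l%:C *: T x.
Proof.
move=> l0 Mx Rx; apply: nonneg_sq_eig => //.
by rewrite recurrent_comm // Rx !linearZ /= Rx linearZ /= scalerA -rmorphM.
Qed.

(** For a preimage [z] in [M], the vector [R^2 z - l^2 z] is in [M] and is killed by [T], which is
    isometric there. *)
Lemma recurrent_eig_surj (l : F) x : 0 < l -> M x -> R x = l%:C *: x ->
  exists z, [/\ M z, R z = l%:C *: z & T z = x].
Proof.
move=> l0 Mx Rx; have [z Mz Tz] := recurrent_surj Tc n_gt0 Mx.
have [_ MD MZ] := recurrent_subspace Tc n.
exists z; split=> //; apply: nonneg_sq_eig => //.
apply/eqP; rewrite -subr_eq0; apply/eqP/nrm_eq0.
have Md : M (R (R z) - (l ^+ 2)%:C *: z).
  by rewrite -scaleNr; apply: MD; [exact: recurrent_R2|exact: MZ].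
rewrite -(recurrent_isometric Tc n_gt0 Md) linearB linearZ /= -recurrent_comm //.
by rewrite Tz Rx linearZ /= Rx scalerA -rmorphM -expr2 subrr nrm0.
Qed.

End Lyapunov.

(** * Orthogonality to the orbit of a star-cyclic vector *)

Section StarCyclic.
Context (F : realType) (H : completeNormedModType F[i]).
Context (dot : {dot H for conjC}) (hdot : induces_norm dot).
Implicit Types (x y z v w : H) (a : F[i]).
Local Notation rdot := (re_dot dot).

Lemma closed_span_orth (A : set H) x y :
  (forall w, A w -> dot w x = 0) -> closed_span A y -> dot y x = 0.
Proof.
move=> Ax /closureP cl; apply: rdot0_dot0.
have h a : rdot (a *: y) x <= 0.
  have k0 : 0 < complex.Re `|a| * nrm x + 1.
    by rewrite ltr_wpDl // mulr_ge0 ?Re_norm_ge0 ?nrm_ge0.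
  apply: (le_addM_gt0 k0) => e e0; rewrite add0r.
  have [_ [[m [c [v [Av ->]]]] ye]] := cl _ e0.
  set s := \sum_(i < m) _ in ye.
  have s0 : rdot (a *: s) x = 0.
    apply: rdot_dot0; rewrite linearZl_LR /= /s linear_sumlz big1 ?mulr0 // => i _.
    by rewrite linearZl_LR /= Ax ?mulr0.
  have -> : rdot (a *: y) x = rdot (a *: (y - s)) x by rewrite scalerBr rdotBl s0 subr0.
  apply: le_trans (rdot_le hdot _ _) _; rewrite nrmZc.
  have : complex.Re `|a| * nrm x * nrm (y - s) <= complex.Re `|a| * nrm x * e.
    by rewrite ler_wpM2l ?mulr_ge0 ?Re_norm_ge0 ?nrm_ge0 // ltW.
  lra.
move=> a; apply/eqP; rewrite eq_le h /= -oppr_le0 -rdotNl -scaleNr; exact: h.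
Qed.

(** [E] is orthogonal to [q], and [V] maps [E] isometrically onto itself, so [E] is orthogonal to
    the whole two-sided orbit of [q], hence to [S], which contains it. *)
Lemma star_cyclic_orth (V : {linear H -> H}) (S E : set H) p q x :
  (forall v, nrm (V v) <= nrm v) -> star_cyclic_on V S q ->
  orthc dot S (p - q) -> E `<=` S -> (forall v, E v -> E (V v)) ->
  (forall v, E v -> exists2 v', E v' & V v' = v) ->
  (forall v, E v -> nrm (V v) = nrm v) ->
  (forall v, E v -> dot v p = 0) -> E x -> x = 0.
Proof.
move=> Vc cyc qS ES EV Vs Vi Ep Ex.
have Eq v : E v -> dot q v = 0.
  move=> Ev; apply/eqP; rewrite -[q](subKr p) linearBl /= (dot0C (Ep _ Ev)).
  by rewrite (qS _ (ES _ Ev)) subrr.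
have dotV k v w : E v -> dot (iter k V w) (iter k V v) = dot w v.
  elim: k v w => //= k IH v w Ev; rewrite isometric_at_dot //.
    exact: IH.
  by apply: Vi; elim: k {IH} => //= k; exact: EV.
have EVk k v : E v -> E (iter k V v) by move=> Ev; elim: k => //= k; exact: EV.
have Vsk k v : E v -> exists2 v', E v' & iter k V v' = v.
  elim: k v => [|k IH] v Ev; first by exists v.
  have [v1 E1 <-] := Vs _ Ev; have [v2 E2 <-] := IH _ E1.
  by exists v2.
have xx : dot x x = 0.
  apply: (@closed_span_orth (orbit_on V S q)); last by rewrite cyc; exact: ES.
  (* Forward orbit: pull [x] back [k] times inside [E]. Backward orbit: push [w] and [x] forward [k]
     times, so that [w] becomes [q]. *)
  move=> w [_ [k [->|wq]]].
    by have [x' Ex' <-] := Vsk k _ Ex; rewrite dotV // Eq.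
  by rewrite -(dotV k) // wq Eq //; exact: EVk.
apply/nrm_eq0/eqP; rewrite -sqrf_eq0 -(rdotxx hdot) rdot_dot0 //.
Qed.

End StarCyclic.

(** * Stability *)

Section Unitary.
Context (F : realType) (H : completeNormedModType F[i]).
Context (dot : {dot H for conjC}) (hdot : induces_norm dot).
Implicit Types (x y z v w : H) (a : F[i]).
Context (U : {linear H -> H}) (hU : unitary_op dot U).

Lemma unitary_nrm x : nrm (U x) = nrm x.
Proof.
apply/eqP; rewrite -(@eqrXn2 _ 2) ?nrm_ge0 // -!(rdotxx hdot) /re_dot.
by rewrite hU.1.
Qed.

(** The preimage of [y] under [U] witnesses the [get] in [adjoint], so the adjoint is the inverse of
    [U]. *)
Lemma unitary_adjointK : cancel (adjoint dot U) U.
Proof.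
move=> y; have sur v : exists x, U x = v.
  by have : range U v by [rewrite hU.2]; case=> x _ <-; exists x.
have spec : [set z | forall x, dot (U x) y = dot x z] (adjoint dot U y).
  apply: getPex; have [z <-] := sur y; exists z => x; exact: hU.1.
apply: (dot_inj hdot) => v; have [x <-] := sur v.
by rewrite hU.1 spec.
Qed.

Lemma unitary_inj : injective U.
Proof.
move=> x y h; apply/eqP; rewrite -subr_eq0; apply/eqP/nrm_eq0.
by rewrite -unitary_nrm linearB /= h subrr nrm0.
Qed.

Lemma adjoint_unitary_nrm y : nrm (adjoint dot U y) = nrm y.
Proof. by rewrite -unitary_nrm unitary_adjointK. Qed.

Lemma adjoint_unitary_linear : linear (adjoint dot U).
Proof. by move=> a x y; apply: unitary_inj; rewrite linearP !unitary_adjointK. Qed.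

Lemma adjoint_unitary_commutes (R : H -> H) : commutes U R ->
  commutes (adjoint dot U) R.
Proof. by move=> UR y; apply: unitary_inj; rewrite UR !unitary_adjointK. Qed.

End Unitary.

Section Stability.
Context (F : realType) (H : completeNormedModType F[i]).
Context (dot : {dot H for conjC}) (hdot : induces_norm dot).
Implicit Types (x y z u v w : H) (a : F[i]).

Lemma closed_span_sub (A : set H) : A `<=` closed_span A.
Proof.
move=> x Ax; apply: subset_closure; exists 1%N, (fun=> 1), (fun=> x).
by split=> //; rewrite big_ord1 scale1r.
Qed.

(** [m] is complex because [eigvals_on] is a set in [F[i]]; [l] is real, so its conjugation in the
    second argument disappears. *)
Lemma dot_eig0 (S : {linear H -> H}) (l : F) (m : F[i]) u w :
  selfadjoint dot S -> S u = l%:C *: u -> S w = m *: w -> m != l%:C ->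
  dot w u = 0.
Proof.
move=> Ssa Su Sw ml; have := Ssa w u; rewrite Su Sw linearZl_LR linearZr_LR /=.
rewrite (_ : (l%:C)^* = l%:C)%R; last by apply: conj_Creal; apply/complex_realP; exists l.
move/eqP; rewrite -subr_eq0 -mulrBl mulf_eq0 subr_eq0 (negbTE ml).
by move/eqP.
Qed.

Lemma compact_op_bounded_cluster (S : {linear H -> H}) (u : nat -> H) c :
  compact_op S -> 0 < c -> (forall k, nrm (u k) <= c) ->
  exists x, seq_cluster (S \o u) x.
Proof.
move=> cS c0 uc.
have [|x hx] := compact_op_cluster (u := fun k => (c^-1)%:C *: u k) cS.
  by move=> k; rewrite nrmZ ?invr_ge0 ?(ltW c0) // ler_pdivrMl // mulr1.
exists (c%:C *: x) => e e0 N.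
have [k Nk] := hx _ (divr_gt0 e0 c0) N; exists k => //=.
have -> : S (u k) - c%:C *: x = c%:C *: (S ((c^-1)%:C *: u k) - x).
  rewrite scalerBr [S (_ *: _)]linearZ /= scalerA -rmorphM /= divff ?scale1r //.
  by rewrite gt_eqF.
by rewrite nrmZ ?(ltW c0) // -ltr_pdivlMl // mulrC.
Qed.

Context (R R1 : {linear H -> H}) (p : H).
Hypotheses (Rcomp : compact_op R) (R1comp : compact_op R1).
Hypotheses (Rsa : selfadjoint dot R) (R1sa : selfadjoint dot R1).
Hypotheses (Rge0 : nonneg_op dot R) (R1ge0 : nonneg_op dot R1).
Hypothesis Rker : ker_op R = [set 0].
Hypothesis hp : forall x, R (R x) - R1 (R1 x) = dot x p *: p.
Context (phi phi1 : {linear H -> H}).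
Hypotheses (phiU : unitary_op dot phi) (phiR : commutes phi R).
Hypotheses (phi1P : partial_isometry dot phi1) (phi1R1 : commutes phi1 R1).

Local Notation psi := (adjoint dot phi).
Local Notation A := (contr_ext R1 R).
Local Notation Sigma := (Sigma_star dot R R1 phi phi1).

Let Aspec := contr_ext_spec hdot Rsa R1sa Rker (nrm_R1_le hdot Rsa R1sa hp).

Lemma Sigma_linear : linear Sigma.
Proof.
move=> a x y; rewrite /Sigma_star (adjoint_unitary_linear hdot phiU).
by case: Aspec => -> _ _; rewrite linearP.
Qed.

Definition Sigma_lin : {linear H -> H} :=
  HB.pack Sigma (GRing.isLinear.Build _ _ _ _ Sigma Sigma_linear).
Local Notation T := Sigma_lin.

Lemma phi1_contraction x : nrm (phi1 x) <= nrm x.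
Proof. exact: partial_isometry_contraction. Qed.

Lemma Sigma_contraction x : nrm (T x) <= nrm x.
Proof.
apply: le_trans (phi1_contraction _) _; case: Aspec => _ Ac _.
by apply: le_trans (Ac _) _; rewrite adjoint_unitary_nrm.
Qed.

Lemma W_contraction x : nrm (phi1 (psi x)) <= nrm x.
Proof. by apply: le_trans (phi1_contraction _) _; rewrite adjoint_unitary_nrm. Qed.

Lemma SigmaR x : T (R x) = R1 (phi1 (psi x)).
Proof.
rewrite /= /Sigma_star (adjoint_unitary_commutes hdot phiU phiR).
by case: Aspec => _ _ ->; rewrite phi1R1.
Qed.

Let H0 := closed_span [set iter n R p | n in [set: nat]].
Let Lam := eigvals_on R H0.
Let Mu := eigvals_on R1 H0 `\ 0.
Let K := closed_span (\bigcup_(l in Lam) eigspace R l) `&` orthc dot H0.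
Let K1 := closed_span (\bigcup_(m in Mu) eigspace R1 m) `&` orthc dot H0.

Lemma orth_H0 (l : F) u : R u = l%:C *: u -> dot u p = 0 -> orthc dot H0 u.
Proof.
move=> Ru up y H0y; apply: dot0C; apply: (closed_span_orth hdot _ H0y) => _ [k _ <-].
elim: k => [|k IH] /=; first exact: dot0C.
by rewrite Rsa Ru linearZr_LR /= IH mulr0.
Qed.

(** For [u = psi v], isometry at [v] leaves no loss in [A u = l^-1 R1 u], so [|R1 u| >= |R u|] and
    [u] is orthogonal to [p]. Then [R1^2 u = R^2 u = l^2 u]. *)
Lemma Sigma_isometric_eig (l : F) v : 0 < l -> R v = l%:C *: v ->
  nrm (T v) = nrm v ->
  [/\ R (psi v) = l%:C *: psi v, R1 (psi v) = l%:C *: psi v,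
      orthc dot H0 (psi v) & T v = phi1 (psi v)].
Proof.
move=> l0 Rv Tv; set u := psi v; case: Aspec => Al Ac AR.
have lC0 : l%:C != 0 :> F[i] by rewrite eq_complex /= eqxx andbT gt_eqF.
have Ru : R u = l%:C *: u.
  apply: (unitary_inj hdot phiU); rewrite phiR linearZ /= unitary_adjointK //.
have AZ a x : A (a *: x) = a *: A x.
  have A0 : A 0 = 0 by apply: nrm_eq0; apply/eqP; rewrite eq_le nrm_ge0 (le_trans (Ac _)) // nrm0.
  by have := Al a x 0; rewrite A0 !addr0.
have lA : l%:C *: A u = R1 u by rewrite -AZ -Ru AR.
have up : dot u p = 0.
  apply: (dot_p_eq0 hdot Rsa R1sa hp); rewrite Ru -lA !nrmZ ?(ltW l0) // ler_pM2l //.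
  rewrite adjoint_unitary_nrm // -Tv; exact: phi1_contraction.
have R1u : R1 u = l%:C *: u.
  apply: (nonneg_sq_eig hdot) => //.
  have /eqP := hp u; rewrite up scale0r subr_eq0 => /eqP <-.
  by rewrite Ru linearZ /= Ru scalerA -rmorphM.
split=> //; first exact: orth_H0 Ru up.
by rewrite /= /Sigma_star -/u; congr (phi1 _); apply: (scalerI lC0); rewrite lA.
Qed.

Hypothesis Hsum : orth_sum3 dot H0 K K1.
Hypothesis phiK1 : forall x, K1 x -> phi x = x.
Hypothesis phi1K : forall x, K x -> phi1 x = x.
Hypothesis cyc : forall l, Lam l ->
  star_cyclic_on phi (eigspace R l) (orth_proj dot (eigspace R l) p).
Hypothesis cyc1 : forall m, Mu m ->
  star_cyclic_on phi1 (eigspace R1 m) (orth_proj dot (eigspace R1 m) p).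

Lemma Sigma_recurrent0 n x : (forall j, (0 < n j)%N) -> recurrent T n x -> x = 0.
Proof.
move=> n0 Mx; apply/eqP/negPn/negP => xn0.
have Tc := Sigma_contraction.
have [l [{xn0}x [l0 {}Mx xn0 Rx]]] := recurrent_eigenvector hdot
  Rcomp Rsa R1sa Rge0 Rker hp Tc W_contraction SigmaR n0 Mx xn0.
pose E := [set v | recurrent T n v /\ R v = l%:C *: v].
have Ei v : E v -> nrm (T v) = nrm v by case=> Mv _; exact: recurrent_isometric.
have ET v : E v -> E (T v).
  move=> [Mv Rv]; split; first exact: recurrent_invariant.
  exact: (recurrent_eig_invariant hdot Rcomp Rsa R1sa Rge0 hp Tc W_contraction SigmaR n0).
have Es v : E v -> exists2 z, E z & T z = v.
  move=> [Mv Rv]; have [z [Mz Rz Tz]] := recurrent_eig_surj hdot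
    Rcomp Rsa R1sa Rge0 hp Tc W_contraction SigmaR n0 l0 Mv Rv.
  by exists z.
have Ep v : E v -> dot v p = 0.
  case=> Mv _.
  exact: (recurrent_orth hdot Rcomp Rsa R1sa hp Tc W_contraction SigmaR n0 Mv).
have Eu v : E v -> [/\ R (psi v) = l%:C *: psi v, R1 (psi v) = l%:C *: psi v,
    orthc dot H0 (psi v) & T v = phi1 (psi v)].
  by move=> Ev; apply: Sigma_isometric_eig => //; [case: Ev|exact: Ei].
have Ex : E x by [].
have psiK v : phi (psi v) = v by exact: unitary_adjointK.
suff : x = 0 by move/eqP; apply/negP.
have [C [C0 hC]] := compact_op_bounded Rcomp.
have [C1 [C10 hC1]] := compact_op_bounded R1comp.
have [lLam|lLam] := pselect (Lam l%:C).
  (* [psi v] lies in [K], where [phi1] is the identity, so [T v = psi v]. *)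
  have phiT v : E v -> phi (T v) = v.
    move=> Ev; have [Ru _ uH0 ->] := Eu _ Ev; rewrite phi1K //.
    split=> //; apply: closed_span_sub; exists l%:C => //.
    by rewrite /eigspace /ker_op /= Ru subrr.
  have [_ orth] := orth_projP hdot p (eigspace_subspace R l%:C)
    (eigspace_closed (a := l%:C) C0 hC).
  apply: (star_cyclic_orth hdot (E := E) _ (cyc lLam) orth) => //.
  - by move=> v; rewrite (unitary_nrm hdot phiU).
  - by move=> v [_ Rv]; rewrite /eigspace /ker_op /= Rv subrr.
  - by move=> v /Es[z Ez <-]; rewrite phiT.
  - by move=> v Ev; exists (T v); [exact: ET|exact: phiT].
  - by move=> v _; rewrite (unitary_nrm hdot phiU).
have [lMu|lMu] := pselect (Mu l%:C).
  (* [psi v] lies in [K1], where [phi] is the identity, so [phi1] agrees with [T] on [E]. *)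
  have psiE v : E v -> psi v = v.
    move=> Ev; have [_ R1u uH0 _] := Eu _ Ev.
    rewrite -{2}(psiK v) phiK1 //; split=> //; apply: closed_span_sub.
    by exists l%:C => //; rewrite /eigspace /ker_op /= R1u subrr.
  have phi1E v : E v -> phi1 v = T v.
    by move=> Ev; have [_ _ _ ->] := Eu _ Ev; rewrite psiE.
  have [_ orth] := orth_projP hdot p (eigspace_subspace R1 l%:C)
    (eigspace_closed (a := l%:C) C10 hC1).
  apply: (star_cyclic_orth hdot (E := E) _ (cyc1 lMu) orth) => //.
  - exact: phi1_contraction.
  - move=> v Ev; have [_ R1u _ _] := Eu _ Ev; rewrite psiE // in R1u.
    by rewrite /eigspace /ker_op /= R1u subrr.
  - by move=> v Ev; rewrite phi1E //; exact: ET.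
  - by move=> v /Es[z Ez <-]; exists z => //; exact: phi1E.
  - by move=> v Ev; rewrite phi1E //; exact: Ei.
(* Neither list contains [l]: [psi x] is orthogonal to [H0] and to all eigenspaces generating [K]
   and [K1], hence to itself. *)
have [Ru R1u uH0 _] := Eu _ Ex.
suff u0 : psi x = 0 by rewrite -(psiK x) u0 linear0.
case: Hsum => _ _ _ /(_ (psi x))[a [b [c [H0a Kb K1c uE]]]].
apply/nrm_eq0/eqP; rewrite -sqrf_eq0 -(rdotxx hdot) rdot_dot0 //.
rewrite {1}uE !linearDl /= (dot0C (uH0 _ H0a)) add0r.
rewrite (closed_span_orth hdot _ Kb.1) ?add0r ?(closed_span_orth hdot _ K1c.1) //.
  move=> w [m Mum]; rewrite /eigspace /ker_op /= => /subr0_eq Rw.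
  by apply: (dot_eig0 R1sa R1u Rw); apply: contra_notN lMu => /eqP <-.
move=> w [m Lm]; rewrite /eigspace /ker_op /= => /subr0_eq Rw.
by apply: (dot_eig0 Rsa Ru Rw); apply: contra_notN lLam => /eqP <-.
Qed.

Lemma Sigma_cvg0_range z : seq_cvg (fun k => iter k T (R z)) 0.
Proof.
(* The orbit is the image under [R] of a bounded sequence; the added 1 keeps the radius positive
   even for [z = 0]. *)
have /choice[y hy] k : exists y, nrm y <= nrm z + 1 /\ iter k T (R z) = R y.
  elim: k => [|k [y [yz IH]]]; first by exists z; split=> //; rewrite lerDl.
  have [y' [y'y Ry']] :=
    douglas_factor hdot Rsa R1sa Rker (nrm_R1_le hdot Rsa R1sa hp) (phi1 (psi y)).
  exists y'; split; last by rewrite iterS IH SigmaR.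
  by apply: le_trans y'y _; apply: le_trans (W_contraction _) _.
have z1 : 0 < nrm z + 1 by rewrite ltr_wpDl ?nrm_ge0.
have [|w hw] := compact_op_bounded_cluster (u := y) Rcomp z1; first by move=> k; case: (hy k).
have {}hw : seq_cluster (fun k => iter k T (R z)) w.
  by move=> e e0 N; have [k Nk] := hw _ e0 N; exists k => //; rewrite (hy k).2.
have [n n0 Mw] := cluster_recurrent Sigma_contraction hw.
have w0 := Sigma_recurrent0 n0 Mw; rewrite {}w0 {n n0 Mw w} in hw.
(* One small iterate suffices, since norms do not increase along the orbit. *)
move=> e e0; have [N _ hN] := hw _ e0 0%N; exists N => k Nk.
apply: le_lt_trans hN; rewrite !subr0 -(subnK Nk) iterD.
exact: iter_contraction Sigma_contraction _ _.
Qed.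

Lemma Sigma_cvg0 x : seq_cvg (fun k => iter k T x) 0.
Proof.
move=> e e0; have e2 : 0 < e / 2 by rewrite divr_gt0.
have /closureP/(_ _ e2)[_ [[z _ <-] xz]] := @range_dense _ _ _ hdot _ Rsa Rker x.
have [N hN] := Sigma_cvg0_range z e2; exists N => k /hN h.
apply: le_lt_trans (nrm_dist _ (iter k T (R z)) _) _.
rewrite [ltRHS]splitr ltrD // -iter_linB.
exact: le_lt_trans (iter_contraction Sigma_contraction _ _) xz.
Qed.

End Stability.

Theorem mainTheorem2 (F : realType) (H : completeNormedModType F[i])
    (dot : {dot H for conjC}) (hdot : induces_norm dot)
    (hsep : separable_space H)
    (R R1 : {linear H -> H}) (p : H)
    (Rcomp : compact_op R) (R1comp : compact_op R1)
    (Rsa : selfadjoint dot R) (R1sa : selfadjoint dot R1)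
    (Rge0 : nonneg_op dot R) (R1ge0 : nonneg_op dot R1)
    (Rker : ker_op R = [set 0])
    (hp : forall x, R (R x) - R1 (R1 x) = dot x p *: p)
    (phi phi1 : {linear H -> H}) :
  let H0 := closed_span [set iter n R p | n in [set: nat]] in
  let Lam := eigvals_on R H0 in
  let Mu := eigvals_on R1 H0 `\ 0 in
  let K := closed_span (\bigcup_(l in Lam) eigspace R l) `&` orthc dot H0 in
  let K1 := closed_span (\bigcup_(m in Mu) eigspace R1 m) `&` orthc dot H0 in
  orth_sum3 dot H0 K K1 ->
  unitary_op dot phi -> commutes phi R ->
  partial_isometry dot phi1 -> commutes phi1 R1 ->
  initial_space dot phi1 = orthc dot (ker_op R1) ->
  final_space phi1 = orthc dot (ker_op R1) ->
  (forall x, K1 x -> phi x = x) ->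
  (forall x, K x -> phi1 x = x) ->
  (forall l, Lam l ->
     star_cyclic_on phi (eigspace R l) (orth_proj dot (eigspace R l) p)) ->
  (forall m, Mu m ->
     star_cyclic_on phi1 (eigspace R1 m) (orth_proj dot (eigspace R1 m) p)) ->
  asymptotically_stable (Sigma_star dot R R1 phi phi1).
Proof.
move=> H0 Lam Mu K K1 Hsum phiU phiR phi1P phi1R1 _ _ phiK1 phi1K cyc cyc1 x.
apply: nrm_cvg0.
exact: (Sigma_cvg0 hdot Rcomp R1comp Rsa R1sa Rge0 R1ge0 Rker hp phiU phiR phi1P phi1R1
  Hsum phiK1 phi1K cyc cyc1).
Qed.
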